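(* Let $\mathbb{X}$ be a complex Banach space and let $T \in \mathbb{L}(\mathbb{X}, \mathbb{X}^* )$. Suppose that $x \in \mathbb{X}$ and $\theta \in [0, 2\pi)$. If $\perp_{T_\theta}$ is left symmetric at $x$, then $\perp_T$ is left symmetric at $x$.
   Context: $\mathbb{X}^*$ is the dual space of $\mathbb{X}$ and $\mathbb{L}(\mathbb{X},\mathbb{X}^* )$ is the set of all bounded linear operators from $\mathbb{X}$ to $\mathbb{X}^*$. Write $(Tx,y) = Tx(y)$. For $x,y\in\mathbb{X}$, $x \perp_T y$ means $(Tx,y)=0$. For $\theta\in[0,2\pi)$, put $(T_\theta x,y) = \cos\theta\,\Re (Tx,y) + \sin\theta\,\Im (Tx,y)$, and $x\perp_{T_\theta} y$ means $(T_\theta x,y)=0$. The relation $\perp_T$ is left symmetric at $x$ if for each $y\in\mathbb{X}$, $x\perp_T y$ implies $y\perp_T x$. The relation $\perp_{T_\theta}$ is left symmetric at $x$ if for each $y\in\mathbb{X}$, $x\perp_{T_\theta} y$ implies $y\perp_{T_\theta} x$. *)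

(* Defs.v *)
From HB Require Import structures.
From mathcomp Require Import all_boot all_order all_algebra complex.
From mathcomp Require Import all_classical all_reals all_analysis.

Set Implicit Arguments.
Unset Strict Implicit.
Unset Printing Implicit Defensive.

Import Order.TTheory GRing.Theory Num.Theory numFieldNormedType.Exports.

Local Open Scope classical_set_scope.
Local Open Scope ring_scope.
Local Open Scope complex_scope.

Section BoundedOperators.
Context {R : realType} (X Y : normedModType R[i]).

Definition bounded_linear (f : X -> Y) : Prop :=
  linear f /\ exists M : R[i], forall x, `|f x| <= M * `|x|.

Definition bounded_op : {pred X -> Y} := fun f => `[< bounded_linear f >].

Record boundedOp := BoundedOp { bounded_op_fun :> X -> Y; _ : bounded_op_fun \in bounded_op }.

HB.instance Definition _ := [isSub for bounded_op_fun].
HB.instance Definition _ := [Choice of boundedOp by <:].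

Lemma bounded_op_submod_closed : submod_closed bounded_op.
Proof.
split.
  apply/asboolP; split=> [a u v|]; first by rewrite /= scaler0 addr0.
  by exists 0 => x /=; rewrite normr0 mul0r.
move=> a f g /asboolP[lf [M fM]] /asboolP[lg [N gN]]; apply/asboolP.
have E x : (a *: f + g) x = a *: f x + g x by [].
split.
  move=> b u v; rewrite !E lf lg !scalerDr !scalerA (mulrC a b) -!addrA.
  by rewrite [X in _ + X]addrCA.
exists (`|a| * M + N) => x; rewrite E mulrDl -mulrA.
apply: le_trans (ler_normD _ _) _; rewrite normrZ.
by apply: lerD => //; rewrite ler_wpM2l.
Qed.

HB.instance Definition _ := GRing.isSubmodClosed.Build _ _ bounded_op
  bounded_op_submod_closed.
HB.instance Definition _ := [SubChoice_isSubLmodule of boundedOp by <:].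

Lemma bounded_op_linear (f : boundedOp) : linear f.
Proof. by case: f => f /= /asboolP[]. Qed.

HB.instance Definition _ (f : boundedOp) :=
  GRing.isLinear.Build _ _ _ _ (bounded_op_fun f) (bounded_op_linear f).

Lemma bounded_op_bounded (f : boundedOp) :
  exists M : R[i], forall x, `|f x| <= M * `|x|.
Proof. by case: f => f /= /asboolP[]. Qed.

Implicit Types f g : boundedOp.

(* The norm of a normedModType R[i] takes its values in R[i] (on the real axis),
   so the supremum is taken in R over real parts and embedded back. *)
Definition op_norms (f : boundedOp) : set R :=
  [set complex.Re `|f x| | x in [set x | `|x| <= 1]].

Definition op_norm (f : boundedOp) : R[i] := (sup (op_norms f))%:C.

Let normE (Z : normedModType R[i]) (z : Z) : (complex.Re `|z|)%:C = `|z|.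
Proof. by rewrite RRe_real// normr_real. Qed.

Lemma op_norms_has_sup f : has_sup (op_norms f).
Proof.
split; first by exists (complex.Re `|f 0|), 0 => //=; rewrite normr0.
have [M fM] := bounded_op_bounded f.
have [B BE] : exists B : R, B%:C = `|M|.
  by exists (complex.Re `|M|); rewrite RRe_real ?normr_real.
exists B => _ [x /= x1 <-]; rewrite -lecR normE BE.
have [->|x0] := eqVneq x 0; first by rewrite linear0 normr0.
have M0 : 0 <= M.
  have := le_trans (normr_ge0 _) (fM x).
  by rewrite pmulr_lge0// normr_gt0.
by rewrite ger0_norm// (le_trans (fM x))// ler_piMr.
Qed.

Lemma op_norm_bound f x : `|f x| <= op_norm f * `|x|.
Proof.
have [->|x0] := eqVneq x 0; first by rewrite linear0 !normr0 mulr0.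
have nx0 : 0 < `|x| by rewrite normr_gt0.
have nx : `| `|x|^-1 *: x | = 1.
  by rewrite normrZ normfV normr_id mulVf ?gt_eqF.
rewrite -ler_pdivrMr// mulrC -[_^-1]ger0_norm; last by rewrite invr_ge0.
rewrite -normrZ -linearZ -(normE (f _)) /op_norm lecR.
apply: ub_le_sup; first exact: (op_norms_has_sup f).2.
by exists (`|x|^-1 *: x); rewrite //= nx.
Qed.

Lemma op_norm_le f (M : R[i]) :
  0 <= M -> (forall x, `|f x| <= M * `|x|) -> op_norm f <= M.
Proof.
move=> M0 fM; rewrite -[M]RRe_real ?ger0_real// /op_norm lecR.
apply: ge_sup; first exact: (op_norms_has_sup f).1.
move=> _ [x /= x1 <-]; rewrite -lecR normE RRe_real ?ger0_real//.
by rewrite (le_trans (fM x))// ler_piMr.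
Qed.

Lemma op_norm_ge0 f : 0 <= op_norm f.
Proof.
rewrite /op_norm ler0c; apply: ub_le_sup; first exact: (op_norms_has_sup f).2.
by exists 0; rewrite /= ?normr0// linear0 normr0.
Qed.

Lemma op_normD f g : op_norm (f + g) <= op_norm f + op_norm g.
Proof.
apply: op_norm_le; first by rewrite addr_ge0 ?op_norm_ge0.
move=> x; rewrite mulrDl (le_trans (ler_normD (f x) (g x)))//.
by rewrite lerD ?op_norm_bound.
Qed.

Let op_normZ_le (a : R[i]) f : op_norm (a *: f) <= `|a| * op_norm f.
Proof.
apply: op_norm_le; first by rewrite mulr_ge0 ?op_norm_ge0.
move=> x; rewrite (_ : (a *: f) x = a *: f x)// normrZ -mulrA.
by rewrite ler_wpM2l ?op_norm_bound.
Qed.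

Lemma op_normZ (a : R[i]) f : op_norm (a *: f) = `|a| * op_norm f.
Proof.
apply/eqP; rewrite eq_le op_normZ_le/=.
have [->|a0] := eqVneq a 0; first by rewrite normr0 mul0r op_norm_ge0.
rewrite -ler_pdivlMl ?normr_gt0// -normfV.
by rewrite -{1}[f](scalerK a0) op_normZ_le.
Qed.

Lemma op_norm0_eq0 f : op_norm f = 0 -> f = 0.
Proof.
move=> f0; apply/val_inj/funext => x; apply/eqP.
by have := op_norm_bound f x; rewrite f0 mul0r normr_le0.
Qed.

HB.instance Definition _ := Lmodule_isNormed.Build R[i] boundedOp
  op_normD op_normZ op_norm0_eq0.

End BoundedOperators.
Arguments boundedOp {R} X Y.

Definition dual {R : realType} (X : normedModType R[i]) : normedModType R[i] :=
  boundedOp X R[i]^o.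

Section Orthogonality.
Context {R : realType} {X : normedModType R[i]} (T : boundedOp X (dual X)).

(* T x is an element of the dual, so T x y is the pairing (Tx, y). *)
Definition orth (x y : X) : Prop := T x y = 0.

Definition pairing_theta (theta : R) (x y : X) : R :=
  cos theta * complex.Re (T x y) + sin theta * complex.Im (T x y).

Definition orth_theta (theta : R) (x y : X) : Prop :=
  pairing_theta theta x y = 0.

End Orthogonality.

Definition left_symmetric_at {X : Type} (r : X -> X -> Prop) (x : X) : Prop :=
  forall y, r x y -> r y x.

(* Main.v *)
(** If [T x y = 0] then also [T x (i y) = 0], so left symmetry of the real
    relation applies to both [y] and [i y].  Since [T (i y) x = i * T y x], the
    two resulting equations say that the vector [T y x] of the plane is
    orthogonal to [(cos theta, sin theta)] and to its rotation by a quarter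
    turn, hence vanishes. *)

Require Import Defs.
From mathcomp Require Import all_boot all_order all_algebra complex.
From mathcomp Require Import all_classical all_reals all_analysis.
From mathcomp Require Import ring.
Import Order.TTheory GRing.Theory Num.Theory numFieldNormedType.Exports.
Local Open Scope ring_scope.

Section Pairing.
Context (R : realType) (X : normedModType R[i]) (T : boundedOp X (dual X)).

Lemma orthZr (c : R[i]) (x y : X) : orth T x y -> orth T x (c *: y).
Proof. by rewrite /orth linearZ /= => ->; rewrite scaler0. Qed.

Lemma pairingZl (c : R[i]) (x y : X) : T (c *: x) y = c * T x y.
Proof. by rewrite linearZ. Qed.

Lemma orth_orth_theta (theta : R) (x y : X) :
  orth T x y -> orth_theta T theta x y.
Proof.
by rewrite /orth /orth_theta /pairing_theta => -> /=; rewrite !mulr0 addr0.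
Qed.

Lemma orth_theta_orth (theta : R) (x y : X) :
  orth_theta T theta x y -> orth_theta T theta ('i%C *: x) y -> orth T x y.
Proof.
rewrite /orth_theta /pairing_theta /orth pairingZl.
(* Since i(a + ib) = -b + ia, [e1] and [e2] form a real linear system in (a, b). *)
case: (T x y) => a b /=; rewrite !mul0r !mul1r sub0r add0r => e1 e2.
have cs := cos2Dsin2 theta.
(* The matrix of the system, with rows (cos, sin) and (sin, -cos), is a reflection, hence its own
   inverse: its rows give the combinations of [e1] and [e2] that isolate a, then b. *)
have -> : a = 0.
  transitivity ((cos theta ^+ 2 + sin theta ^+ 2) * a); first by rewrite cs mul1r.
  transitivity (cos theta * (cos theta * a + sin theta * b)
              + sin theta * (cos theta * - b + sin theta * a)); first by ring.
  by rewrite e1 e2 !mulr0 addr0.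
have -> // : b = 0.
transitivity ((cos theta ^+ 2 + sin theta ^+ 2) * b); first by rewrite cs mul1r.
transitivity (sin theta * (cos theta * a + sin theta * b)
            - cos theta * (cos theta * - b + sin theta * a)); first by ring.
by rewrite e1 e2 !mulr0 subr0.
Qed.

End Pairing.

Theorem theorem2p3 (R : realType) (X : completeNormedModType R[i])
    (T : boundedOp X (dual X)) (x : X) (theta : R)
    (htheta : 0 <= theta < 2 * pi) :
  left_symmetric_at (orth_theta T theta) x -> left_symmetric_at (orth T) x.
Proof.
move=> sym y xy; apply: (@orth_theta_orth _ _ _ theta).
  exact/sym/orth_orth_theta.
(* The factor ['i] must be absorbed at the level of [orth], as [pairing_theta] is only
   real-linear. *)
exact/sym/orth_orth_theta/orthZr.
Qed.
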